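(* Let $H=\bigotimes_{i=1}^NH_i$ be a Hilbert space with $\dim H_i=d_i$, and let $\rho$ and $\rho'$ be two $N$-partite mixed states over $H$. Then $\rho$ and $\rho'$ are LU equivalent if and only if there exists a $(d_1\cdots d_N)\times(d_1\cdots d_N)$ unitary matrix $P$ such that $$\rho'=P\rho P^{\dagger}$$ and $$\operatorname{rank}\bigl(R\bigl(P_{j|\widehat j}\bigr)\bigr)=1\qquad\text{for each } j=1,2,\dots,N.$$
   Context: The $H_i$ are finite-dimensional complex Hilbert spaces with fixed orthonormal bases; a mixed state is a density matrix (positive semidefinite, trace one) on $H$, written in the product basis. Two mixed states $\rho,\rho'$ are LU (local unitary) equivalent if $\rho'=(U_1\otimes\cdots\otimes U_N)\rho(U_1\otimes\cdots\otimes U_N)^{\dagger}$ for some unitary $d_i\times d_i$ matrices $U_i$. Realignment: for a matrix $Y$, $\mathrm{vec}(Y)$ is the column vector obtained by stacking the columns of $Y$. For an $m\times m$ block matrix $Z=(Z_{pq})$ with blocks of size $n\times n$, $R(Z)=[\mathrm{vec}(Z_{11}),\dots,\mathrm{vec}(Z_{m1}),\dots,\mathrm{vec}(Z_{1m}),\dots,\mathrm{vec}(Z_{mm})]^{\mathrm t}$, an $m^2\times n^2$ matrix. Bipartite partition: rows and columns of $P$ are indexed by multi-indices $(k_1,\dots,k_N)$, $1\le k_l\le d_l$, corresponding to the product basis of $H$. $P_{j|\widehat j}$ is $P$ regarded as a $d_j\times d_j$ block matrix whose $(p,q)$ block, of size $(d_1\cdots d_N/d_j)\times(d_1\cdots d_N/d_j)$,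 consists of the entries with row index $k_j=p$ and column index $k_j=q$, the rows and columns inside the block being indexed by the remaining indices $(k_l)_{l\ne j}$ in a fixed common order. *)

(* Defs.v *)
From mathcomp Require Import all_boot all_order all_algebra.
From mathcomp Require Import complex reals.

Set Implicit Arguments.
Unset Strict Implicit.
Unset Printing Implicit Defensive.

Import Order.TTheory GRing.Theory Num.Theory.
Local Open Scope ring_scope.
Local Open Scope sesquilinear_scope.

(* Multi-indices (k_i)_{i in I} with k_i ranging over d_i values (counted from
   0), labelling the product basis of the tensor product of spaces of
   dimensions d_i.  A matrix on that tensor product has size #|midx d|, its
   rows and columns being identified with multi-indices by [enum_val] and
   [enum_rank]. *)
Notation midx d := {dffun forall i, 'I_(d i)}.

Section MultiIndices.
Local Open Scope nat_scope.

Lemma card_midx (I : finType) (d : I -> nat) :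
  #|midx d| = \prod_(i : I) d i.
Proof.
rewrite card_dep_ffun -/(image _ _) foldrE big_map big_enum /=.
by apply: eq_bigr => i _; rewrite card_ord.
Qed.

Variables (N : nat) (d : 'I_N -> nat) (j : 'I_N).

Definition dim_others (l : {l : 'I_N | l != j}) : nat := d (val l).

(* The multi-index with j-th component p and remaining components r. *)
Definition extend_midx (p : 'I_(d j)) (r : midx dim_others) : midx d :=
  [ffun i : 'I_N =>
     match eqVneq i j with
     | EqNotNeq e => cast_ord (congr1 d (esym e)) p
     | NeqNotEq ne => r (exist _ i ne)
     end].

Lemma extend_midx_at p r : extend_midx p r j = p.
Proof.
rewrite ffunE; case: eqVneq => [e|ne]; last by case/eqP: (ne).
by rewrite (eq_irrelevance e erefl) cast_ord_id.
Qed.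

Lemma extend_midx_others p r l : extend_midx p r (val l) = r l.
Proof.
case: l => i ne; rewrite ffunE /=; case: eqVneq => [e|ne'].
  by exfalso; rewrite e eqxx in ne.
by rewrite (bool_irrelevance ne' ne).
Qed.

End MultiIndices.

Section States.
Variable C : numClosedFieldType.

Definition psdmx n (A : 'M[C]_n) : Prop :=
  A \is hermsymmx /\ forall v : 'cV[C]_n, 0 <= (v^t* *m A *m v) 0 0.

Definition mixed_state n (rho : 'M[C]_n) : Prop := psdmx rho /\ \tr rho = 1.

(* U_1 (x) ... (x) U_N in the product basis: its entry at multi-indices (k, l)
   is the product of the entries (U_i)_{k_i, l_i}. *)
Definition tensor_mx N (d : 'I_N -> nat) (U : forall i, 'M[C]_(d i)) :
    'M[C]_(#|midx d|) :=
  \matrix_(a, b < #|midx d|) \prod_(i < N) U i (enum_val a i) (enum_val b i).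

Definition LU_equivalent N (d : 'I_N -> nat) (rho rho' : 'M[C]_(#|midx d|)) :
    Prop :=
  exists U : forall i, 'M[C]_(d i),
    (forall i, U i \is unitarymx) /\
    rho' = tensor_mx U *m rho *m (tensor_mx U)^t*.

End States.

Section Realignment.
Variable C : fieldType.

(* Column stacking; [mxvec] lists the entries row by row, hence the
   transpositions. *)
Definition vec m n (Y : 'M[C]_(m, n)) : 'cV[C]_(n * m) := (mxvec Y^T)^T.

(* The inner row of blocks runs over the block-row index p and the outer one
   over the block-column index q, so that the columns under the transposition
   are vec Z_11, ..., vec Z_m1, ..., vec Z_1m, ..., vec Z_mm.  The number of
   rows is written as the sum of m * m ones. *)
Definition realign m n (Z : 'M[C]_(\sum_(p < m) n, \sum_(q < m) n)) :
    'M[C]_(\sum_(q < m) \sum_(p < m) 1, n * n) :=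
  (\mxrow_(q < m) \mxrow_(p < m) vec (submxblock Z p q))^T.

(* P_{j|^j}: P as a d_j x d_j block matrix whose (p, q) block collects the
   entries with row index k_j = p and column index k_j = q, the remaining
   indices being enumerated in the same order in every block. *)
Definition bipartition N (d : 'I_N -> nat) (j : 'I_N) (P : 'M[C]_(#|midx d|)) :=
  let n := #|midx (dim_others d (j := j))| in
  \mxblock_(p < d j, q < d j)
    (\matrix_(a < n, b < n)
       P (enum_rank (extend_midx p (enum_val a)))
         (enum_rank (extend_midx q (enum_val b)))).

End Realignment.

(* Main.v *)
Require Import Defs.
From mathcomp Require Import all_boot all_order all_algebra.
From mathcomp Require Import complex reals.

Set Implicit Arguments.
Unset Strict Implicit.
Unset Printing Implicit Defensive.

Import Order.TTheory GRing.Theory Num.Theory.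
Local Open Scope ring_scope.
Local Open Scope sesquilinear_scope.

(* A block matrix whose realignment has rank 1 is a single block scaled by the
   entries of a small matrix, so the rank conditions say that the entries of P
   factor along each tensor slot separately.  Fixing a nonzero entry
   P(k0, l0) and moving the other multi-indices to it one coordinate at a time
   gives P = c (V_1 (x) ... (x) V_N).  When P is unitary,
   |c|^2 (V_1 V_1^* (x) ... (x) V_N V_N^* ) = 1 forces every V_i V_i^* to be a
   positive scalar r_i, so that U_i = V_i / sqrt r_i is unitary; the tensor
   product of the U_i is then P up to a phase, and conjugation does not see the
   phase. *)

(** Pairing values with their tag turns dependent functions into ordinary ones, to which the usual
    distributivity applies. *)
Lemma bigA_distr_dffun (R : pzSemiRingType) (I : finType) (T : I -> finType)
    (F : forall i, T i -> R) :
  \prod_i \sum_(x : T i) F i x =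
  \sum_(f : {dffun forall i, T i}) \prod_i F i (f i).
Proof.
rewrite (reindex (@dffun_of_fprod I T)) /=; last first.
  exact/onW_bij/dffun_of_fprod_bij.
under [RHS]eq_bigr => f _ do under eq_bigr => i _ do
  rewrite ffunE -(ffunE (F i)).
rewrite (@big_fprod _ _ _ _ _ _ _ (fun i => [ffun x => F i x])).
under eq_bigr => i _ do rewrite (big_tag F i).
rewrite bigA_distr_big_dep; apply: eq_bigr => f _; apply: eq_bigr => i _.
by rewrite /untag; case: eqP => // e; rewrite ffunE.
Qed.

(** * Block matrices with rank-one realignment *)

Section RankOneRealign.
Variable C : fieldType.

Lemma vec_inj m n : injective (@vec C m n).
Proof. by move=> A B /trmx_inj /(can_inj mxvecK) /trmx_inj. Qed.

Lemma vec0 m n : vec (0 : 'M[C]_(m, n)) = 0.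
Proof. by rewrite /vec trmx0 linear0 trmx0. Qed.

Lemma vecZ m n (a : C) (A : 'M_(m, n)) : vec (a *: A) = a *: vec A.
Proof. by rewrite /vec !linearZ. Qed.

(** The columns of the transposed realignment [M] are the vectorised blocks, and transposition keeps
    the rank: rank 1 means that they are all multiples of one vector and not all zero. *)
Lemma rank_realign_eq1P m n (B : 'I_m -> 'I_m -> 'M[C]_n) :
  \rank (realign (\mxblock_(p < m, q < m) B p q)) = 1%N <->
  (exists u Y, forall p q, B p q = u p q *: Y) /\ (exists p q, B p q != 0).
Proof.
rewrite /realign mxrank_tr; set M := mxrow _.
have blockM p q : submxrow (submxrow M q) p = vec (B p q).
  by rewrite !mxrowK mxblockK.
split=> [rk1 | [[u [Y BE]] [p0 [q0 nz0]]]].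
  split.
    (* Rank factorisation: [c] is one column and [r] one row, so each vectorised block is [c] times
       an entry of [r]; [Y] is [c] folded back into a matrix. *)
    have := mulmx_base M; move: (col_base M) (row_base M); rewrite rk1.
    move=> c r Mcr.
    exists (fun p q => submxrow (submxrow r q) p 0 0), (vec_mx c^T)^T.
    move=> p q; apply: vec_inj; rewrite -blockM -Mcr -!mul_submxrow.
    rewrite [submxrow (submxrow r q) p]mx11_scalar mul_mx_scalar !mxE vecZ.
    by rewrite /vec trmxK vec_mxK trmxK.
  have [/existsP[p /existsP[q nz]]|/existsPn allz] :=
    boolP [exists p, [exists q, B p q != 0]]; first by exists p, q.
  have M0 : M = 0.
    apply/mxrowP => q; apply/mxrowP => p; rewrite blockM !submxrow0.
    have /existsPn/(_ q)/negPn/eqP-> := allz p.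
    by rewrite vec0.
  by rewrite M0 mxrank0 in rk1.
apply/eqP; rewrite eqn_leq lt0n mxrank_eq0; apply/andP; split; last first.
  apply: contraNneq nz0 => M0; apply/eqP/vec_inj.
  by rewrite -blockM M0 !submxrow0 vec0.
(* Factoring through dimension 1 bounds the rank by 1. *)
have -> : M = vec Y *m \mxrow_(q < m) \mxrow_(p < m) (u p q)%:M.
  apply/mxrowP => q; apply/mxrowP => p.
  by rewrite blockM BE -!mul_submxrow !mxrowK mul_mx_scalar vecZ.
exact: mulmx_max_rank.
Qed.

End RankOneRealign.

(** * From separability in each slot to a product form *)

Section Separability.
Variables (N : nat) (d : 'I_N -> nat).
Implicit Types (k l : midx d) (j : 'I_N).

Definition others j k : midx (dim_others d (j := j)) :=
  [ffun l => k (val l)].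

Definition update_midx k j (p : 'I_(d j)) : midx d :=
  extend_midx p (others j k).

Lemma update_midx_at k j (p : 'I_(d j)) : update_midx k p j = p.
Proof. exact: extend_midx_at. Qed.

Lemma update_midx_out k j (p : 'I_(d j)) i : i != j -> update_midx k p i = k i.
Proof.
move=> ne; transitivity (others j k (exist _ i ne)); last by rewrite ffunE.
exact: (extend_midx_others p (others j k) (exist _ i ne)).
Qed.

Lemma update_midx_id k j : update_midx k (k j) = k.
Proof.
apply/ffunP => i; have [->|ne] := eqVneq i j; first exact: update_midx_at.
exact: update_midx_out.
Qed.

Lemma extend_midx_out j (p q : 'I_(d j)) r i :
  i != j -> extend_midx p r i = extend_midx q r i.
Proof.
move=> ne; transitivity (r (exist _ i ne)); last apply/esym.
  exact: (extend_midx_others p r (exist _ i ne)).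
exact: (extend_midx_others q r (exist _ i ne)).
Qed.

Lemma extend_midx_inj j p q r :
  (extend_midx p r == extend_midx q r :> midx d) = (p == q :> 'I_(d j)).
Proof.
apply/eqP/eqP => [E|-> //].
by rewrite -[p](extend_midx_at p r) E extend_midx_at.
Qed.

(** A stage on the path from [k0] to [k]: [s] lists the coordinates already moved. *)
Definition mix_midx (s : seq 'I_N) k0 k : midx d :=
  [ffun i => if i \in s then k i else k0 i].

Lemma mix_midx_cons i s k0 k :
  mix_midx (i :: s) k0 k = update_midx (mix_midx s k0 k) (k i).
Proof.
apply/ffunP => j; rewrite ffunE inE.
have [->|ne] /= := eqVneq j i; first by rewrite update_midx_at.
by rewrite update_midx_out // ffunE.
Qed.

(** The effect of moving one slot does not depend on the other slots: each move multiplies [Q] by a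
    ratio that can be read off at the base point [(k0, l0)]. *)
Lemma product_form_of_rank1 (F : fieldType) (Q : midx d -> midx d -> F) k0 l0 :
    Q k0 l0 != 0 ->
    (forall j, exists u Y, forall (p q : 'I_(d j)) r s,
       Q (extend_midx p r) (extend_midx q s) = u p q * Y r s) ->
  exists V : forall j, 'M[F]_(d j),
    forall k l, Q k l = Q k0 l0 * \prod_j V j (k j) (l j).
Proof.
move=> nz0 sep.
(* Exchanging the slot [j] parts of two entries preserves their product, since each entry is a
   factor from slot [j] times a factor from the rest. *)
have cross j k l (p q : 'I_(d j)) :
    Q (update_midx k p) (update_midx l q) * Q k0 l0 =
    Q (update_midx k0 p) (update_midx l0 q) *
    Q (update_midx k (k0 j)) (update_midx l (l0 j)).
  have [u [Y E]] := sep j.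
  rewrite -[k0 in LHS](update_midx_id k0 j) -[l0 in LHS](update_midx_id l0 j).
  by rewrite /update_midx !E mulrACA [RHS]mulrACA [Y _ _ * _]mulrC.
pose V j : 'M[F]_(d j) :=
  \matrix_(p, q) (Q (update_midx k0 p) (update_midx l0 q) / Q k0 l0).
exists V => k l; pose W j := V j (k j) (l j).
have mixE s : uniq s ->
    Q (mix_midx s k0 k) (mix_midx s l0 l) = Q k0 l0 * \prod_(i <- s) W i.
  elim: s => [_|i s IHs /= /andP[i_s /IHs{}IHs]].
    by rewrite big_nil mulr1; congr Q; apply/ffunP => i; rewrite ffunE.
  rewrite big_cons !mix_midx_cons; apply: (mulIf nz0); rewrite cross.
  (* Slot [i] has not moved yet, so resetting it to its base value changes nothing. *)
  have mix_i (m0 m : midx d) :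
      update_midx (mix_midx s m0 m) (m0 i) = mix_midx s m0 m.
    rewrite -[RHS](update_midx_id _ i); congr update_midx.
    by rewrite ffunE (negPf i_s).
  by rewrite !mix_i IHs [W i]mxE [in RHS]mulrCA [RHS]mulrAC divfK.
have full (m0 m : midx d) : m = mix_midx (index_enum 'I_N) m0 m.
  by apply/ffunP => i; rewrite ffunE mem_index_enum.
by rewrite [k in LHS](full k0) [l in LHS](full l0) mixE // index_enum_uniq.
Qed.

End Separability.

Lemma trmxCZ (C : numClosedFieldType) m n (a : C) (A : 'M_(m, n)) :
  (a *: A)^t* = a^* *: A^t*.
Proof. by rewrite linearZ /= map_mxZ. Qed.

(** * Algebra of tensor products of matrices *)

Section TensorProduct.
Variable C : numClosedFieldType.
Variables (N : nat) (d : 'I_N -> nat).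
Implicit Types (U V G : forall i, 'M[C]_(d i)) (P rho : 'M[C]_(#|midx d|)).

Lemma tensor_mxE U (k l : midx d) :
  tensor_mx U (enum_rank k) (enum_rank l) = \prod_i U i (k i) (l i).
Proof. by rewrite mxE !enum_rankK. Qed.

Lemma mx_midxP P P' :
  (forall k l : midx d, P (enum_rank k) (enum_rank l) =
                        P' (enum_rank k) (enum_rank l)) -> P = P'.
Proof.
by move=> E; apply/matrixP => a b; rewrite -(enum_valK a) -(enum_valK b).
Qed.

Lemma exists_midx_neq0 P :
  P != 0 -> exists k l : midx d, P (enum_rank k) (enum_rank l) != 0.
Proof.
case/matrix0Pn => a [b nz].
by exists (enum_val a), (enum_val b); rewrite !enum_valK.
Qed.

(** Distributing the product of the slotwise sums yields one sum over the intermediate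
    multi-index. *)
Lemma tensor_mxM U V :
  tensor_mx (fun i => U i *m V i) = tensor_mx U *m tensor_mx V.
Proof.
apply: mx_midxP => k l; rewrite tensor_mxE mxE.
under eq_bigr do rewrite mxE.
rewrite (bigA_distr_dffun (fun i x => U i (k i) x * V i x (l i))).
rewrite (reindex enum_rank) /=; last exact/onW_bij/enum_rank_bij.
by apply: eq_bigr => m _; rewrite !tensor_mxE big_split.
Qed.

Lemma tensor_mxZ (a : 'I_N -> C) U :
  tensor_mx (fun i => a i *: U i) = (\prod_i a i) *: tensor_mx U.
Proof.
apply: mx_midxP => k l; rewrite [RHS]mxE !tensor_mxE -big_split.
by apply: eq_bigr => i _; rewrite mxE.
Qed.

Lemma tensor_mx_tC U : tensor_mx (fun i => (U i)^t*) = (tensor_mx U)^t*.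
Proof.
apply: mx_midxP => k l; rewrite tensor_mxE !mxE !enum_rankK rmorph_prod.
by apply: eq_bigr => i _; rewrite !mxE.
Qed.

Lemma tensor_mx1 : tensor_mx (fun i => 1%:M : 'M[C]_(d i)) = 1%:M.
Proof.
apply: mx_midxP => k l; rewrite tensor_mxE mxE (inj_eq enum_rank_inj).
have [->|ne] := eqVneq k l; first by rewrite big1 // => i _; rewrite mxE eqxx.
have [i nei] : exists i, k i != l i.
  apply/existsP; apply: contra_neqT ne => /existsPn E.
  by apply/ffunP => i; apply/eqP/negPn.
by rewrite (bigD1 i) //= mxE (negPf nei) mul0r.
Qed.

Lemma eq_tensor_mx U V : (forall i, U i = V i) -> tensor_mx U = tensor_mx V.
Proof.
move=> E; apply: mx_midxP => k l; rewrite !tensor_mxE.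
by apply: eq_bigr => i _; rewrite E.
Qed.

(** * Unitary tensor products and their factors *)

Lemma tensor_mx_unitary U :
  (forall i, U i \is unitarymx) -> tensor_mx U \is unitarymx.
Proof.
move=> Uu; apply/unitarymxP; rewrite -tensor_mx_tC -tensor_mxM -tensor_mx1.
by apply: eq_tensor_mx => i; apply/unitarymxP.
Qed.

(** With all coordinates but the [i]-th frozen at those of [m], the identity reads
    [t *: G i = 1%:M], so [r] is the inverse of [t]. *)
Lemma tensor_mx_scalar_factors (a : C) G (m : midx d) i :
  a *: tensor_mx G = 1%:M -> exists2 r, r != 0 & G i = r%:M.
Proof.
move=> E; pose t := a * \prod_(l | l != i) G l (m l) (m l).
have Gt p q : t * G i p q = (p == q)%:R.
  have := congr1 (fun M : 'M_#|midx d| => M (enum_rank (update_midx m p))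
    (enum_rank (update_midx m q))) E.
  rewrite !mxE !enum_rankK (inj_eq enum_rank_inj) extend_midx_inj => <-.
  rewrite (bigD1 i) //= !update_midx_at /t -mulrA [X in a * X]mulrC.
  by congr (_ * (_ * _)); apply: eq_bigr => l ne; rewrite !update_midx_out.
have t0 : t != 0.
  apply: contra_eq_neq (Gt (m i) (m i)) => ->.
  by rewrite mul0r eqxx eq_sym oner_eq0.
exists t^-1; first by rewrite invr_eq0.
apply/matrixP => p q; rewrite mxE; apply: (mulfI t0).
by rewrite Gt mulrnAr mulfV.
Qed.

(** The multi-index [m] excludes size 0, where the zero matrix is unitary. *)
Lemma unitarymx_neq0 P (m : midx d) : P \is unitarymx -> P != 0.
Proof.
move=> Pu; apply: contraTneq Pu => ->; apply/unitarymxP.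
rewrite mul0mx => /matrixP/(_ (enum_rank m) (enum_rank m)).
by rewrite !mxE eqxx => /esym/eqP; rewrite oner_eq0.
Qed.

Lemma unitary_tensor_factors (c : C) V (m : midx d) :
    c *: tensor_mx V \is unitarymx ->
  exists U (a : C), (forall i, U i \is unitarymx) /\
                    tensor_mx U = a *: (c *: tensor_mx V).
Proof.
move=> Pu; have c0 : c != 0.
  by apply: contraNneq (unitarymx_neq0 m Pu) => ->; rewrite scale0r.
have gram : (c * c^*) *: tensor_mx (fun i => V i *m (V i)^t*) = 1%:M.
  move/unitarymxP: Pu; rewrite tensor_mxM tensor_mx_tC => <-.
  by rewrite trmxCZ -scalemxAl -scalemxAr scalerA.
have /fin_all_exists2[r r0 VV] i := tensor_mx_scalar_factors m i gram.
(* [r i] is a diagonal entry of a Gram matrix, hence a sum of squared moduli. *)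
have r_gt0 i : 0 < r i.
  have : (V i *m (V i)^t*) (m i) (m i) = r i by rewrite VV mxE eqxx.
  rewrite lt_def r0 mxE => <-; apply: sumr_ge0 => q _.
  by rewrite !mxE mul_conjC_ge0.
pose s i := (sqrtC (r i))^-1.
have s_gt0 i : 0 < s i by rewrite invr_gt0 sqrtC_gt0.
(* Dividing by [c] undoes the given scalar; that [a] has modulus 1 is deduced later, from unitarity
   of both sides. *)
exists (fun i => s i *: V i), ((\prod_i s i) / c); split=> [i|].
  apply/unitarymxP; rewrite trmxCZ -scalemxAl -scalemxAr VV.
  rewrite conj_Creal ?ger0_real ?ltW // scalerA -expr2 exprVn sqrtCK.
  by rewrite scale_scalar_mx mulVf.
by rewrite tensor_mxZ scalerA mulfVK.
Qed.

(** * Rank conditions and local unitary equivalence *)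

Lemma bipartition_rank1P j P :
  \rank (realign (bipartition j P)) = 1%N <->
  P != 0 /\ exists u Y, forall (p q : 'I_(d j)) r s,
    P (enum_rank (extend_midx p r)) (enum_rank (extend_midx q s)) =
    u p q * Y r s.
Proof.
rewrite rank_realign_eq1P; split=> [[[u [Y E]] [p [q nz]]]|[nz [u [Y E]]]].
  split.
    by apply: contraNneq nz => ->; apply/eqP/matrixP => a b; rewrite !mxE.
  exists u, (fun r s => Y (enum_rank r) (enum_rank s)) => p' q' r s.
  have /matrixP/(_ (enum_rank r) (enum_rank s)) := E p' q'.
  by rewrite !mxE !enum_rankK.
split.
  exists u, (\matrix_(a, b) Y (enum_val a) (enum_val b)) => p q.
  by apply/matrixP => a b; rewrite !mxE E.
(* A nonzero entry at [(k, l)] lies in block [(k j, l j)], at the position given by the remaining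
   coordinates. *)
have [k [l nzkl]] := exists_midx_neq0 nz.
exists (k j), (l j); apply: contraNneq nzkl.
move=> /matrixP/(_ (enum_rank (others j k)) (enum_rank (others j l))).
rewrite !mxE !enum_rankK => /eqP.
by rewrite -/(update_midx k (k j)) -/(update_midx l (l j)) !update_midx_id.
Qed.

(** Without multi-indices the trace would be an empty sum, not 1. *)
Lemma mixed_state_midx P : mixed_state P -> inhabited (midx d).
Proof.
case=> _ trP; have [m _ | no_midx] := pickP (fun _ : midx d => true).
  by split.
have tr0 : \tr P = 0 by apply: big1 => a; have := no_midx (enum_val a).
by move/eqP: trP; rewrite tr0 eq_sym oner_eq0.
Qed.

Lemma LU_equivalentP (m : midx d) rho rho' :
  LU_equivalent rho rho' <->
  exists P : 'M[C]_(#|midx d|),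
    [/\ P \is unitarymx,
        rho' = P *m rho *m P^t*
      & forall j : 'I_N, \rank (realign (bipartition j P)) = 1%N].
Proof.
split=> [[U [Uu rhoE]] | [P [Pu rhoE rk1]]].
  have Pu := tensor_mx_unitary Uu; exists (tensor_mx U); split=> // j.
  apply/bipartition_rank1P; split; first exact: unitarymx_neq0 m Pu.
  (* [Y] collects the slots other than [j]; [m j] is a placeholder coordinate that this product
     never reads. *)
  exists (U j), (fun r s => \prod_(l | l != j)
    U l (extend_midx (m j) r l) (extend_midx (m j) s l)) => p q r s.
  rewrite tensor_mxE (bigD1 j) //= !extend_midx_at; congr (_ * _).
  by apply: eq_bigr => l ne; rewrite !(extend_midx_out _ (m j)).
have [k [l nzkl]] := exists_midx_neq0 (unitarymx_neq0 m Pu).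
have [|V PV] := product_form_of_rank1
  (Q := fun k l => P (enum_rank k) (enum_rank l)) nzkl.
  by move=> j; have /bipartition_rank1P[] := rk1 j.
have {}PV : P = P (enum_rank k) (enum_rank l) *: tensor_mx V.
  by apply: mx_midxP => k' l'; rewrite [RHS]mxE tensor_mxE PV.
move: (P _ _) PV => c PV.
have := Pu; rewrite {1}PV => /(unitary_tensor_factors m)[U [a [Uu]]].
rewrite -PV => UE; exists U; split=> //.
(* Both [P] and [a *: P] are unitary, so [a * a^* = 1], which is exactly the scalar that conjugation
   by [a *: P] produces. *)
have := unitarymxP (tensor_mx_unitary Uu).
rewrite UE trmxCZ -!scalemxAl -!scalemxAr !scalerA (unitarymxP Pu) rhoE.
move=> /matrixP/(_ (enum_rank m) (enum_rank m)).
by rewrite !mxE eqxx mulr1 => ->; rewrite scale1r.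
Qed.

End TensorProduct.

Theorem theorem8 (R : realType) (N : nat) (d : 'I_N -> nat)
    (rho rho' : 'M[R[i]]_(#|midx d|))
    (rho_state : mixed_state rho) (rho'_state : mixed_state rho') :
  LU_equivalent rho rho' <->
  exists P : 'M[R[i]]_(#|midx d|),
    [/\ P \is unitarymx,
        rho' = P *m rho *m P^t*
      & forall j : 'I_N, \rank (realign (bipartition j P)) = 1%N].
Proof.
by have [m] := mixed_state_midx rho_state; apply: LU_equivalentP m _ _.
Qed.
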